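(* Let $\Omega\subseteq\mathbb{C}^n$, $n\geqslant 1$, be a non-void open set endowed with the pluri-fine topology $\tau$. Then $B_1(\Omega,\mathbb{R})=H_1^*(\Omega,\mathbb{R})$.
   Context: Plurisubharmonic functions: with $\mathbb{C}^n$, $\mathbb{C}$, $[-\infty,\infty)$ carrying the Euclidean topologies, a function $u:\Omega\to[-\infty,\infty)$ on a non-void open set $\Omega\subseteq\mathbb{C}^n$ is plurisubharmonic (psh) if $u$ is upper semicontinuous and, for all $a,b\in\mathbb{C}^n$, the function $z\mapsto u(a+bz)$ is subharmonic or identically $-\infty$ on every connected component of $\{z\in\mathbb{C}: a+bz\in\Omega\}$. The pluri-fine topology $\tau$ on $\Omega$ is the coarsest topology on $\Omega$ in which all psh functions $u:\Omega\to[-\infty,\infty)$ are continuous. For topological spaces $X,Y$: $B_1(X,Y)$ is the set of first Baire class functions, i.e. functions $f:X\to Y$ that are pointwise limits on $X$ of a sequence of continuous functions $f_k:X\to Y$. A subset $A\subseteq X$ is functionally closed if $A=f^{-1}(0)$ for some continuous $f:X\to[0,1]$. $H_1^*(X,Y)$ is the set of first functional Lebesgue class functions, i.e. functions $f:X\to Y$ such that for every open $G\subseteq Y$ the set $f^{-1}(G)$ is a countable union of functionally closed subsets of $X$. $\mathbb{R}$ has the Euclidean topology. *)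

(* Defs.v *)
From HB Require Import structures.
From mathcomp Require Export all_boot all_order all_algebra.
From mathcomp Require Export all_classical all_reals all_analysis.
From mathcomp Require Export complex.
Export Order.TTheory GRing.Theory Num.Theory.
Export numFieldTopology.Exports numFieldNormedType.Exports.

Set Implicit Arguments.
Unset Strict Implicit.
Unset Printing Implicit Defensive.

Local Open Scope classical_set_scope.
Local Open Scope ring_scope.
Local Open Scope complex_scope.

(* The Euclidean topology of the complex numbers: balls for the modulus. It
   also induces the Euclidean (product) topology on row vectors 'rV[R[i]]_n. *)
#[non_forgetful_inheritance]
HB.instance Definition _ (R : realType) :=
  PseudoPointedMetric.copy R[i] (R[i])^o.

(* Functions on a subset D of X with values in [-oo, +oo[ are given by total
   functions X -> \bar R; only their values on D matter. *)
Section functions_on_a_subset.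
Context {R : realType} {X : topologicalType}.
Implicit Types (D : set X) (u : X -> \bar R).

Definition usc_on D u :=
  forall a : R, open [set x : D | (u (\val x) < a%:E)%E].

Definition lty_on D u := forall x, D x -> (u x < +oo)%E.

Definition eqNy_on D u := forall x, D x -> u x = -oo%E.

End functions_on_a_subset.

Section subharmonic.
Context {R : realType}.

Definition closed_disc (z : R[i]) (r : R) : set R[i] :=
  [set w | `|w - z| <= r%:C].

Definition circle_point (z : R[i]) (r t : R) : R[i] :=
  z + ((r * cos t) +i* (r * sin t)).

(* For u usc and < +oo on the circle, the positive part of u is bounded there,
   so that the Lebesgue integral is well defined, with values in [-oo, +oo[. *)
Definition circle_mean (u : R[i] -> \bar R) (z : R[i]) (r : R) : \bar R :=
  (((2 * pi)^-1)%R%:E *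
    \int[lebesgue_measure]_(t in `[0%R, (2 * pi)%R]) u (circle_point z r t))%E.

(* V is meant to be open and connected; the constant function -oo is not
   counted as subharmonic. *)
Definition subharmonic (V : set R[i]) (u : R[i] -> \bar R) :=
  [/\ lty_on V u, usc_on V u, ~ eqNy_on V u &
      forall z r, 0 < r -> closed_disc z r `<=` V ->
        (u z <= circle_mean u z r)%E].

End subharmonic.

Section pluri_fine.
Context {R : realType} {n : nat}.

Definition psh (Om : set 'rV[R[i]]_n) (u : 'rV[R[i]]_n -> \bar R) :=
  [/\ lty_on Om u, usc_on Om u &
      forall (a b : 'rV[R[i]]_n) (z0 : R[i]),
        let D := [set z : R[i] | Om (a + z *: b)] in
        let V := connected_component D z0 in
        let v := fun z : R[i] => u (a + z *: b) in
        D z0 -> subharmonic V v \/ eqNy_on V v].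

(* The type Om with the supremum of the initial topologies of the psh functions
   on Om. The topology of [-oo, +oo[ is induced by that of \bar R, whence
   continuity into either is the same. *)
Definition pluri_fine (Om : set 'rV[R[i]]_n) : topologicalType :=
  sup_topology (fun u : {u : 'rV[R[i]]_n -> \bar R | psh Om u} =>
    Topological.on (initial_topology (fun x : Om => sval u (\val x)))).

End pluri_fine.

Section baire_lebesgue.

Definition baire1 (X Y : topologicalType) : set (X -> Y) :=
  [set f | exists F : nat -> X -> Y,
    (forall k, continuous (F k)) /\
    (forall x, F k x @[k --> \oo] --> f x)].

Definition functionally_closed (R : realType) (X : topologicalType)
    (A : set X) :=
  exists f : X -> R,
    [/\ continuous f, (forall x, 0 <= f x <= 1) & A = f @^-1` [set 0]].

Definition functional_lebesgue1 (R : realType) (X Y : topologicalType) :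
    set (X -> Y) :=
  [set f | forall G : set Y, open G ->
    exists A : nat -> set X,
      (forall k, functionally_closed R (A k)) /\
      f @^-1` G = \bigcup_k A k].

End baire_lebesgue.

(* Main.v *)
Require Import Defs.
From mathcomp Require Import lra.

(** The two classes of real functions agree on every topological space X
([baire1_eq_functional_lebesgue1]); the pluri-fine topology is an instance.

If f is the pointwise limit of continuous functions F_k and G is open, then x
lies in the preimage of G under f iff, for some compact interval [p, q] with
rational end points contained in G, all F_k x with k large lie in [p, q]. This
writes the preimage as a countable union of sets, each of which is a countable
intersection of preimages of closed intervals; such an intersection is
functionally closed ([functionally_closed_bigcap]).

Conversely, let preimages under f of open sets be countable unions of
functionally closed sets, and enumerate the rationals as q_0, q_1, etc. For each
i, the sets where f > q_i and where f < q_i are increasing unions over k of zero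
sets of continuous functions a_(i,k) and b_(i,k) respectively
([functional_lebesgue1_exhaustion]). At stage k it is enough to find one
continuous F_k with F_k >= q_i on the zeros of a_(i,k) and F_k <= q_i on the
zeros of b_(i,k) for all i < k: any rationals p < f x < r then end up bounding
F_k x, whence F_k x tends to f x. Such an F_k is an explicit maximum of minima
of continuous functions ([finite_interpolation]). *)

Set Implicit Arguments.
Unset Strict Implicit.
Unset Printing Implicit Defensive.

Local Open Scope classical_set_scope.
Local Open Scope ring_scope.

Section functionally_closed_sets.
Context {R : realType} {X : topologicalType}.
Implicit Types (f g : X -> R) (A : (set X)^nat).

Lemma functionally_closed_zeros f :
  continuous f -> functionally_closed R (f @^-1` [set 0]).
Proof.
move=> fC; exists (fun x => Num.min `|f x| 1); split.
- move=> x; apply: (@continuous_min _ _ (fun x => `|f x|) (cst 1)).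
    by apply: cvg_norm; exact: fC.
  exact: cvg_cst.
- by move=> x; rewrite le_min normr_ge0 ler01 ge_min lexx orbT.
- apply/seteqP; split => x /=; first by move=> ->; rewrite normr0 min_l.
  by case: leP => [_ /normr0_eq0//|_ /eqP]; rewrite oner_eq0.
Qed.

Lemma functionally_closed0 : functionally_closed R (@set0 X).
Proof.
exists (cst 1); split.
- by move=> x; exact: cvg_cst.
- by move=> x; rewrite ler01 lexx.
- by apply/seteqP; split => x //= /eqP; rewrite oner_eq0.
Qed.

Lemma functionally_closed_itv_preimage f (p q : R) :
  continuous f -> functionally_closed R (f @^-1` `[p, q]).
Proof.
move=> fC.
have gC : continuous (fun x => Num.max 0 (Num.max (p - f x) (f x - q))).
  move=> x; apply: (@continuous_max _ _ (cst 0)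
    (fun x => Num.max (p - f x) (f x - q))); first exact: cvg_cst.
  apply: (@continuous_max _ _ (fun x => p - f x) (fun x => f x - q)).
    by apply: cvgB; [exact: cvg_cst|exact: fC].
  by apply: cvgB; [exact: fC|exact: cvg_cst].
have -> : f @^-1` `[p, q] =
    (fun x => Num.max 0 (Num.max (p - f x) (f x - q))) @^-1` [set 0].
  apply/seteqP; split => x /=; rewrite in_itv/=.
    by move=> pfq; rewrite max_l// ge_max !subr_le0.
  by move=> /max_idPl; rewrite ge_max !subr_le0.
exact: functionally_closed_zeros.
Qed.

(** If A k is the zero set of g k >= 0, the intersection is the zero set of the
supremum over k of the truncations min (g k) 1/(k+1). The truncation leaves the
zeros unchanged and makes the supremum continuous: up to a given error only
finitely many k matter. *)
Lemma functionally_closed_bigcap A :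
  (forall k, functionally_closed R (A k)) ->
  functionally_closed R (\bigcap_k A k).
Proof.
move=> /choice[g gP].
have gC k : continuous (g k) by have [] := gP k.
have g0 k x : 0 <= g k x by have [_ /(_ x)/andP[]] := gP k.
have gA k x : A k x <-> g k x = 0 by have [_ _ ->] := gP k.
pose m k x := Num.min (g k x) k.+1%:R^-1.
have m0 k x : 0 <= m k x by rewrite le_min g0/= invr_ge0.
have mle k x : m k x <= k.+1%:R^-1 by rewrite ge_min lexx orbT.
have mC k : continuous (m k).
  move=> x; apply: (@continuous_min _ _ (g k) (cst _)); first exact: gC.
  exact: cvg_cst.
pose h x := sup (range (m ^~ x)).
have m_bounded x : has_ubound (range (m ^~ x)).
  exists 1 => _ [k _ <-]; apply: le_trans (mle k x) _.
  by rewrite invf_le1 ?ler1n.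
have mh k x : m k x <= h x by apply: ub_le_sup => //; exists k.
have hle x c : (forall k, m k x <= c) -> h x <= c.
  move=> mc; apply: ge_sup; first by exists (m 0%N x), 0%N.
  by move=> _ [k _ <-].
have -> : \bigcap_k A k = h @^-1` [set 0].
  apply/seteqP; split => x /=.
    move=> Ax; apply/eqP; rewrite eq_le (le_trans (m0 0%N x))// andbT.
    by apply: hle => k; rewrite /m (gA k x).1 ?ge_min ?lexx//; exact: Ax.
  move=> hx0 k _; apply/gA; apply/eqP; rewrite eq_le g0 andbT.
  have := mh k x; rewrite hx0 /m ge_min => /orP[//|].
  by rewrite leNgt invr_gt0 ltr0Sn.
apply: functionally_closed_zeros => x.
apply/cvgrPdist_le => e e0.
have [n n_e] : exists n, n.+1%:R^-1 < e.
  have [N _ /(_ N (leqnn N))] := near_infty_natSinv_lt (PosNum e0).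
  by exists N.
(* Indices k >= n need no care: m k takes its values in [0, e] everywhere. *)
have near_m : \forall y \near x, forall k : 'I_n, `|m k x - m k y| <= e.
  by apply: filter_forall => k; apply: cvgr_dist_le => //; exact: mC.
apply: filterS near_m => y mxyn.
have mxy k : `|m k x - m k y| <= e.
  have [kn|nk] := ltnP k n.
    exact: (mxyn (Ordinal kn)).
  have mke z : m k z <= e.
    apply: le_trans (mle k z) _; apply: le_trans (ltW n_e).
    by rewrite lef_pV2 ?posrE// ler_nat.
  by rewrite ler_distl; move: (mke x) (mke y) (m0 k x) (m0 k y); lra.
rewrite ler_distl; apply/andP; split.
  rewrite lerBlDr; apply: hle => k; apply: le_trans (_ : m k x + e <= _).
    by move: (mxy k); rewrite ler_distl; lra.
  by rewrite lerD2r.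
apply: hle => k; apply: le_trans (_ : m k y + e <= _).
  by move: (mxy k); rewrite ler_distl; lra.
by rewrite lerD2r.
Qed.

End functionally_closed_sets.

Section baire1_functional_lebesgue1.
Context {R : realType} {X : topologicalType}.
Implicit Types (f : X -> R) (q : nat -> R).

Lemma countType_enumeration (T : countType) (x0 : T) :
  exists e : nat -> T, forall x, exists k, e k = x.
Proof.
exists (fun k => odflt x0 (unpickle k)) => x.
by exists (pickle x); rewrite pickleK.
Qed.

Lemma rat_itv_subset_open (G : set R) (y : R) : open G -> G y ->
  exists p q : rat, [/\ ratr p < y, y < ratr q & `[ratr p, ratr q] `<=` G].
Proof.
move=> Go Gy; have /nbhs_ballP[e /= e0 eG] : nbhs y G by exact: open_nbhs_nbhs.
have [|p] := @rat_in_itvoo R (y - e) y; first by rewrite ltrBlDr ltrDl.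
rewrite in_itv/= => /andP[ep py].
have [|q] := @rat_in_itvoo R y (y + e); first by rewrite ltrDl.
rewrite in_itv/= => /andP[yq qe].
exists p, q; split=> // z /=; rewrite in_itv/= => /andP[pz zq].
by apply: eG; rewrite /ball/= ltr_distl; move: ep qe pz zq; lra.
Qed.

(** An interval that is closed survives the passage to the limit, and an interval
whose interior contains the limit captures the tail of the sequence: the
compact rational intervals inside G thus decide membership of the limit. *)
Lemma baire1_functional_lebesgue1 :
  @baire1 X R `<=` @functional_lebesgue1 R X R.
Proof.
move=> f [F [FC Ff]] G Go.
(* The union over all intervals [p, q] inside G and all starting ranks N is
   indexed by an enumeration of the triples (p, q, N). *)
have [t tP] := countType_enumeration (0%Q, 0%Q, 0%N).
pose I k : set R := [set` `[ratr (t k).1.1, ratr (t k).1.2]].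
pose A k := if pselect (I k `<=` G) then
  \bigcap_i (F ((t k).2 + i)%N @^-1` I k) else set0.
exists A; split.
  move=> k; rewrite /A; case: pselect => [IG|IG]; last first.
    exact: functionally_closed0.
  apply: functionally_closed_bigcap => i.
  exact: functionally_closed_itv_preimage.
apply/seteqP; split => [x /= Gfx|x [k _]].
  have [p [q [pf fq pqG]]] := rat_itv_subset_open Go Gfx.
  have [N _ FN] : \forall k \near \oo, ratr p <= F k x <= ratr q.
    near=> k; apply/andP; split; near: k.
      exact: (cvgr_ge _ (Ff x)).
    exact: (cvgr_le _ (Ff x)).
  have [k tk] := tP (p, q, N).
  exists k => //; rewrite /A /I tk; case: pselect => [pqG'|//] i _ /=.
  by rewrite in_itv/= FN//= leq_addr.
rewrite /A; case: pselect => [IG Bx|//]; apply: (IG).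
have FN : \forall i \near \oo, ratr (t k).1.1 <= F i x <= ratr (t k).1.2.
  exists (t k).2 => // i /= ti.
  by have := Bx (i - (t k).2)%N Logic.I; rewrite /I/= in_itv/= subnKC.
rewrite /I /= in_itv/=; apply/andP; split.
  by apply: (cvgr_to_ge (Ff x)); apply: filterS FN => i /andP[].
by apply: (cvgr_to_le (Ff x)); apply: filterS FN => i /andP[].
Unshelve. all: by end_near. Qed.

(** For a single pair (i, j), it is easy to find a continuous function h i j that
is at least q i on the zeros of a i and at most q j on the zeros of b j: if
q i <= q j the constant q i does, and otherwise these zeros are disjoint and one
interpolates as in Urysohn's lemma for zero sets. The maximum over i of the
minimum over j of h i j satisfies all the constraints together. *)
Lemma finite_interpolation (n : nat) q (a b : nat -> X -> R) :
  (forall i, continuous (a i)) -> (forall i, continuous (b i)) ->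
  (forall i j x, q j < q i -> 0 < a i x + b j x) ->
  exists F : X -> R, continuous F /\ forall i x, (i < n)%N ->
    (a i x = 0 -> q i <= F x) /\ (b i x = 0 -> F x <= q i).
Proof.
move=> aC bC ab0.
pose h i j x : R :=
  if q j < q i then q j + (q i - q j) * (b j x / (a i x + b j x)) else q i.
have hC i j : continuous (h i j).
  move=> x; rewrite /h; case: (boolP (q j < q i)) => qji; last exact: cvg_cst.
  apply: cvgD; first exact: cvg_cst.
  apply: cvgM; first exact: cvg_cst.
  apply: cvgM; first exact: bC.
  apply: cvgV; first by rewrite gt_eqF// ab0.
  by apply: cvgD; [exact: aC|exact: bC].
have ha i j x : a i x = 0 -> q i <= h i j x.
  move=> ai0; rewrite /h; case: ifPn => // qji.
  have := ab0 _ _ x qji; rewrite ai0 add0r => bj0.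
  by rewrite divff ?gt_eqF// mulr1 addrC subrK.
have hb i j x : b j x = 0 -> h i j x <= q j.
  move=> bj0; rewrite /h; case: ltP => // _.
  by rewrite bj0 mul0r mulr0 addr0.
(* The default values of the extrema respect the constraints: q i is h i i, and d
   is below all the q j. *)
pose d := \big[Num.min/0]_(j < n) q j.
exists (fun x =>
  \big[Num.max/d]_(i < n) \big[Num.min/q i]_(j < n) h i j x); split.
  apply: continuous_big; first exact: max_continuous.
  move=> i _; apply: continuous_big; first exact: min_continuous.
  by move=> j _; exact: hC.
move=> i x ltin; pose i' := Ordinal ltin; split=> [ai0|bi0].
  apply: le_trans (le_bigmax _ _ i').
  by apply: le_bigmin => // j _; exact: ha.
apply: bigmax_le => [|k _]; first exact: (bigmin_le _ i').
by apply: le_trans (bigmin_le _ i' _) _; exact: hb.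
Qed.

(** Products of the first functions defining the zero sets turn their union into
an increasing one, so that every point of the preimage is reached at all late
stages; this is what pointwise convergence calls for. *)
Lemma functional_lebesgue1_exhaustion f (G : set R) :
  functional_lebesgue1 R f -> open G ->
  exists a : nat -> X -> R, [/\ forall k, continuous (a k),
    forall k x, 0 <= a k x,
    forall k x, a k x = 0 -> G (f x) &
    forall x, G (f x) -> \forall k \near \oo, a k x = 0].
Proof.
move=> fL /fL[A [/choice[c cP] fGA]].
have cA k x : A k x <-> c k x = 0 by have [_ _ ->] := cP k.
exists (fun k x => \prod_(l < k.+1) c l x); split.
- move=> k; apply: continuous_big; first exact: mul_continuous.
  by move=> l _; have [] := cP l.
- by move=> k x; apply: prodr_ge0 => l _; have [_ /(_ x)/andP[]] := cP l.
- move=> k x /eqP/prodf_eq0[l _ /eqP/cA Alx].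
  by change ((f @^-1` G) x); rewrite fGA; exists l.
- move=> x Gfx; have [l _ /cA clx0] : (\bigcup_k A k) x by rewrite -fGA.
  exists l => // k /= lk; apply/eqP/prodf_eq0.
  by exists (Ordinal (lk : (l < k.+1)%N)) => //=; rewrite clx0.
Qed.

Lemma functional_lebesgue1_baire1 :
  @functional_lebesgue1 R X R `<=` @baire1 X R.
Proof.
move=> f fL.
have [t tP] := countType_enumeration 0%Q.
pose q i : R := ratr (t i).
have /choice[a aP] i :=
  functional_lebesgue1_exhaustion fL (@open_gt R (q i)).
have /choice[b bP] i :=
  functional_lebesgue1_exhaustion fL (@open_lt R (q i)).
have /choice[F FP] k : exists F : X -> R, continuous F /\
    forall i x, (i < k)%N ->
      (a i k x = 0 -> q i <= F x) /\ (b i k x = 0 -> F x <= q i).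
  apply: (@finite_interpolation k q (a ^~ k) (b ^~ k)).
  - by move=> i; have [] := aP i.
  - by move=> i; have [] := bP i.
  (* A common zero would give q i < f x < q j, against q j < q i. *)
  move=> i j x qji; have [_ a0 aG _] := aP i; have [_ b0 bG _] := bP j.
  rewrite lt_def addr_ge0// andbT paddr_eq0//.
  apply/negP => /andP[/eqP/aG/= qif /eqP/bG/= fqj].
  by have := lt_trans (lt_trans fqj qji) qif; rewrite ltxx.
exists F; split=> [k|x]; first by have [] := FP k.
apply/cvgrPdist_le => e e0.
have [p [r [pf fr pr_ball]]] :=
  rat_itv_subset_open (ball_open (f x) e) (ballxx (f x) e0).
have [i ti] := tP p; have [j tj] := tP r.
rewrite -ti in pf pr_ball; rewrite -tj in fr pr_ball.
have ai0 : \forall k \near \oo, a i k x = 0 by have [_ _ _] := aP i; apply.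
have bj0 : \forall k \near \oo, b j k x = 0 by have [_ _ _] := bP j; apply.
near=> k; have [_ Fk] := FP k.
have [ik jk] : (i < k)%N /\ (j < k)%N.
  by split; near: k; exact: nbhs_infty_gt.
have qF : q i <= F k x by apply: (Fk i x ik).1; near: k.
have Fq : F k x <= q j by apply: (Fk j x jk).2; near: k.
by apply/ltW/pr_ball; rewrite /= in_itv/= qF.
Unshelve. all: by end_near. Qed.

Lemma baire1_eq_functional_lebesgue1 :
  @baire1 X R = @functional_lebesgue1 R X R.
Proof.
apply/seteqP; split.
  exact: baire1_functional_lebesgue1.
exact: functional_lebesgue1_baire1.
Qed.

End baire1_functional_lebesgue1.

Theorem corollary2p5 (R : realType) (n : nat) (n_ge1 : (1 <= n)%N)
    (Om : set 'rV[R[i]]_n) (Om_open : open Om) (Om_nonvoid : (Om !=set0)%classic) :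
  @baire1 (pluri_fine Om) R = @functional_lebesgue1 R (pluri_fine Om) R.
Proof. exact: baire1_eq_functional_lebesgue1. Qed.
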